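(* Let $S$ be an investment strategy with parameter space $\mathbb W=\mathcal W_k^\ell$ ($k\ge2$, $\ell\ge1$) on a market with $m$ assets. Fix $\varepsilon\in(0,1)$ and suppose $S$ satisfies condition $(\mathrm L_\varepsilon)$ and condition $(\mathrm D_c)$ for some constant $c>0$. Then $\mathcal U(S)$ is a universalization of $S$.
   Context: Let $m\ge2$. A market sequence is a sequence of return vectors $\mathbf x_0,\mathbf x_1,\dots\in(0,\infty)^m$. For $k\ge2$ let $\mathcal W_k=\{\mathbf w\in[0,1]^k:\sum_{i=1}^k w_i=1\}$. An investment strategy $S$ with parameter space $\mathbb W=\mathcal W_k^\ell$ (elements written $\mathbf w=(\mathbf w_1,\dots,\mathbf w_\ell)$, $\mathbf w_\iota=(w_{\iota1},\dots,w_{\iota k})$) assigns to every day $t\ge0$ and $\mathbf w\in\mathbb W$ an investment description $S_t(\mathbf w)=(S_{t1}(\mathbf w),\dots,S_{tm}(\mathbf w))\in\mathcal W_m$ (it may depend on market data observed before day $t$), measurable in $\mathbf w$. Its cumulative return is $\mathcal R_n(\mathbf w)=\mathcal R_n(S(\mathbf w))=\prod_{t=0}^{n-1}S_t(\mathbf w)\cdot\mathbf x_t$ (with $\mathcal R_0\equiv1$), and $\mathcal L_n(S(\mathbf w))=\frac1n\log\mathcal R_n(\mathbf w)$. For a parameter-free strategy $U$ with descriptions $U_t\in\mathcal W_m$, $\mathcal R_n(U)=\prod_{t=0}^{n-1}U_t\cdot\mathbf x_t$ and $\mathcal L_n(U)=\frac1n\log\mathcal R_n(U)$. $\mu$ denotes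 the uniform probability measure on $\mathbb W$ (normalized product of $(k-1)$-dimensional Lebesgue measure on each factor $\mathcal W_k$). The universalization $\mathcal U(S)$ is the parameter-free strategy with $\mathcal U_t(S)=\dfrac{\int_{\mathbb W}S_t(\mathbf w)\mathcal R_t(\mathbf w)\,d\mu(\mathbf w)}{\int_{\mathbb W}\mathcal R_t(\mathbf w)\,d\mu(\mathbf w)}$. A parameter-free strategy $U$ is a universalization of $S$ if there is a sequence $\eta_n\to0$, not depending on the market data, such that $\mathcal L_n(U)\ge\sup_{\mathbf w\in\mathbb W}\mathcal L_n(S(\mathbf w))-\eta_n$ for all $n\ge1$ and all market sequences. Condition $(\mathrm L_\varepsilon)$: $S_{ti}(\mathbf w)\ge\frac{\varepsilon}{2m(t+1)^2}$ for all $t\ge0$, $1\le i\le m$, $\mathbf w\in\mathbb W$. Condition $(\mathrm D_c)$: for all $t\ge0$, $1\le i\le m$ and $\mathbf w,\mathbf w'\in\mathbb W$, $|S_{ti}(\mathbf w)-S_{ti}(\mathbf w')|\le c(t+1)\sum_{\iota=1}^\ell\sum_{j=1}^{k-1}|w_{\iota j}-w'_{\iota j}|$ (this holds in particular if each $S_{ti}$ is differentiable in the free coordinates $w_{\iota j}$, $j\le k-1$, where $w_{\iota k}=1-\sum_{j<k}w_{\iota j}$, with all partial derivatives bounded in absolute value by $c(t+1)$). *)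

(* Defs.v *)
From HB Require Import structures.
From mathcomp Require Import all_boot all_order all_algebra.
From mathcomp Require Import all_classical all_reals all_analysis.
Set Implicit Arguments. Unset Strict Implicit. Unset Printing Implicit Defensive.
Import Order.TTheory GRing.Theory Num.Theory.
Local Open Scope classical_set_scope.
Local Open Scope ring_scope.

Section Defs.
Variable R : realType.

Definition inSimplex (k : nat) (v : 'I_k -> R) : Prop :=
  (forall j, 0 <= v j) /\ \sum_(j < k) v j = 1.

Definition inW (l k : nat) (w : 'I_l -> 'I_k -> R) : Prop :=
  forall iota, inSimplex (w iota).

Definition market (m : nat) (x : nat -> 'I_m -> R) : Prop :=
  forall t i, 0 < x t i.

Definition nonanticipating (m : nat) (A : Type)
  (S : (nat -> 'I_m -> R) -> nat -> A) : Prop :=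
  forall x y t, (forall s, (s < t)%N -> x s = y s) -> S x t = S y t.

Definition cumret (m : nat) (P : Type)
  (S : (nat -> 'I_m -> R) -> nat -> P -> 'I_m -> R)
  (x : nat -> 'I_m -> R) (n : nat) (w : P) : R :=
  \prod_(t < n) \sum_(i < m) S x t w i * x t i.

Definition cumret0 (m : nat) (U : (nat -> 'I_m -> R) -> nat -> 'I_m -> R)
  (x : nat -> 'I_m -> R) (n : nat) : R :=
  \prod_(t < n) \sum_(i < m) U x t i * x t i.

Definition Lgrowth (n : nat) (r : R) : R := ln r / n%:R.

(* free coordinates w_{iota j}, j <= k-1 (1-indexed), i.e. val j < k.-1 *)
Definition freecoords (l k : nat) : seq ('I_l * 'I_k) :=
  [seq p <- [seq (i, j) | i <- enum 'I_l, j <- enum 'I_k] | (val p.2 < k.-1)%N].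

Definition complete (l k : nat) (v : 'I_l -> 'I_k -> R) : 'I_l -> 'I_k -> R :=
  fun i j => if (val j < k.-1)%N then v i j
             else 1 - \sum_(j' < k | (val j' < k.-1)%N) v i j'.

Definition setcoord (l k : nat) (v : 'I_l -> 'I_k -> R) (p : 'I_l * 'I_k) (a : R) :
  'I_l -> 'I_k -> R :=
  fun i j => if (i == p.1) && (j == p.2) then a else v i j.

Fixpoint iterint (l k : nat) (s : seq ('I_l * 'I_k))
  (G : ('I_l -> 'I_k -> R) -> \bar R) (v : 'I_l -> 'I_k -> R) : \bar R :=
  match s with
  | [::] => G v
  | p :: s' => (\int[@lebesgue_measure R]_(a in `[0%R, 1%R])
                   iterint s' G (setcoord v p a))%E
  end.

(* Lebesgue integral of F over W, in free coordinates (the product of the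
   (k-1)-dimensional Lebesgue measures on the factors W_k) *)
Definition lebW (l k : nat) (F : ('I_l -> 'I_k -> R) -> R) : \bar R :=
  iterint (freecoords l k)
    (fun v => ((\1_[set v' | inW (complete v')] v) * F (complete v))%:E)
    (fun _ _ => 0).

(* integral w.r.t. the uniform probability measure mu on W *)
Definition intmu (l k : nat) (F : ('I_l -> 'I_k -> R) -> R) : R :=
  fine (lebW F) / fine (lebW (l:=l) (k:=k) (fun _ => 1)).

Definition universalization (m l k : nat)
  (S : (nat -> 'I_m -> R) -> nat -> ('I_l -> 'I_k -> R) -> 'I_m -> R) :
  (nat -> 'I_m -> R) -> nat -> 'I_m -> R :=
  fun x t i => intmu (fun w => S x t w i * cumret S x t w)
               / intmu (fun w => cumret S x t w).

Definition is_universalization (m l k : nat)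
  (U : (nat -> 'I_m -> R) -> nat -> 'I_m -> R)
  (S : (nat -> 'I_m -> R) -> nat -> ('I_l -> 'I_k -> R) -> 'I_m -> R) : Prop :=
  [/\ nonanticipating U,
      (forall x, market x -> forall t, inSimplex (U x t)) &
      exists eta : nat -> R, eta @ \oo --> 0 /\
        forall n, (1 <= n)%N -> forall x, market x ->
          forall w, inW w ->
            Lgrowth n (cumret0 U x n) >= Lgrowth n (cumret S x n w) - eta n].

End Defs.

(* Main.v *)
Require Import Defs.
From HB Require Import structures.
From mathcomp Require Import all_boot all_order all_algebra.
From mathcomp Require Import all_classical all_reals all_analysis.
From mathcomp Require Import measurable_realfun ring lra.
Set Implicit Arguments. Unset Strict Implicit. Unset Printing Implicit Defensive.
Import Order.TTheory GRing.Theory Num.Theory.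
Import numFieldNormedType.Exports.
Local Open Scope classical_set_scope.
Local Open Scope ring_scope.

(** The daily returns of the universalization telescope, so that its cumulative
    return is the mean of [cumret S x n] over the parameter space. Given any
    parameter [w], shrinking towards an origin corner yields a box of side of
    order [n^-4] inside the parameter space, close enough to [w] for the lower
    bound and the Lipschitz bound on [S] to give a return of at least half that
    of [w] throughout the box. The mean is thus at least the return of [w] times
    a negative power of [n], and the loss in the growth rate is O(log n / n). *)

(** * Measurability and bounds for the iterated integral over coordinates *)

Section ParamSpace.
Context {R : realType} {l k : nat}.
Local Notation V := ('I_l -> 'I_k -> R).

(** Generators of the product sigma-algebra, which is put on the alias [paramT] of [V]. *)
Definition cylinders : set (set V) :=
  [set A | exists i j, exists2 B : set R,
             measurable B & A = (fun v : V => v i j) @^-1` B].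

Definition paramT : Type := V.

HB.instance Definition _ := gen_eqMixin paramT.
HB.instance Definition _ := gen_choiceMixin paramT.
HB.instance Definition _ := isPointed.Build paramT (fun _ _ => 0).
HB.instance Definition _ := @isMeasurable.Build (sigma_display cylinders)
  paramT <<s cylinders >> (@sigma_algebra0 _ setT cylinders)
  (@sigma_algebraC paramT cylinders) (@sigma_algebra_bigcup _ setT cylinders).

Local Notation mu := (@lebesgue_measure R).
Local Notation I01 := (`[0%R, 1%R]%classic : set R).

Lemma measurable_coord (i : 'I_l) (j : 'I_k) :
  measurable_fun [set: paramT] (fun v : paramT => v i j).
Proof.
move=> _ B mB; rewrite setTI; apply: sub_sigma_algebra.
by exists i, j, B.
Qed.

Lemma measurable_setcoord p :
  measurable_fun [set: paramT * R]
    (fun va : paramT * R => setcoord va.1 p va.2 : paramT).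
Proof.
refine (@measurability _ _ _ paramT _ _ cylinders erefl _) => _ [_ [i [j [B mB ->]]] <-].
rewrite /setcoord /=.
have [e|e] := boolP ((i == p.1) && (j == p.2)).
  rewrite (_ : _ @^-1` _ = snd @^-1` B); first exact: measurable_snd.
  by apply/seteqP; split => va /=; rewrite e.
rewrite (_ : _ @^-1` _ = (fun va : paramT * R => va.1 i j) @^-1` B).
  exact: (measurableT_comp (measurable_coord i j) measurable_fst).
by apply/seteqP; split => va /=; rewrite (negbTE e).
Qed.

Lemma measurable_setcoord1 p (v : V) :
  measurable_fun [set: R] (fun a : R => setcoord v p a : paramT).
Proof.
exact: (measurableT_comp (measurable_setcoord p) (pair1_measurable _)).
Qed.

Lemma iterint_ge0 s (G : V -> \bar R) :
  (forall v, 0 <= G v)%E -> forall v, (0 <= iterint s G v)%E.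
Proof.
by move=> G0; elim: s => //= p s IH v; apply: integral_ge0 => a _; exact: IH.
Qed.

(** By induction on [s]: each further integration is a partial integral of a nonnegative function
    jointly measurable in [(v, a)], so Tonelli applies. *)
Lemma measurable_iterint s (G : paramT -> \bar R) :
  measurable_fun [set: paramT] G -> (forall v, 0 <= G v)%E ->
  measurable_fun [set: paramT] (iterint s G : paramT -> \bar R).
Proof.
move=> mG G0; elim: s => //= p s IH.
(* Extension by zero off [0,1] turns this into an integral over the whole line, as in Tonelli's
   theorem. *)
pose f (va : paramT * R) := ((fun a => iterint s G (setcoord va.1 p a)) \_ I01) va.2.
rewrite (_ : (fun v => _) = fubini_F mu f); last first.
  by apply/funext => v; rewrite integral_mkcond.
apply: measurable_fun_fubini_tonelli_F; last first.
  by move=> va; rewrite /f patchE; case: ifP => // _; exact: iterint_ge0.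
have mD : measurable (@snd paramT R @^-1` I01).
  by rewrite -[X in measurable X]setTI; exact: measurable_snd.
rewrite (_ : f = (fun va => iterint s G (setcoord va.1 p va.2)) \_ (@snd paramT R @^-1` I01)).
  apply/(measurable_restrictT _ mD)/measurable_funTS.
  exact: (measurableT_comp IH (measurable_setcoord p)).
by apply/funext => va; rewrite /f !patchE; congr (if _ then _ else _).
Qed.


Lemma measurable_iterint1 s p v (G : paramT -> \bar R) :
  measurable_fun [set: paramT] G -> (forall v, 0 <= G v)%E ->
  measurable_fun I01 (fun a => iterint s G (setcoord v p a)).
Proof.
move=> mG G0; apply: measurable_funTS.
exact: (measurableT_comp (measurable_iterint s mG G0) (measurable_setcoord1 p v)).
Qed.

Lemma le_iterint s (G H : paramT -> \bar R) :
  measurable_fun [set: paramT] G -> measurable_fun [set: paramT] H ->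
  (forall v, 0 <= G v)%E -> (forall v, G v <= H v)%E ->
  forall v, (iterint s G v <= iterint s H v)%E.
Proof.
move=> mG mH G0 GH; elim: s => //= p s IH v.
have H0 v' : (0 <= H v')%E by exact: le_trans (G0 v') (GH v').
apply: ge0_le_integral => //.
- by move=> a _; exact: iterint_ge0.
- exact: measurable_iterint1.
- exact: measurable_iterint1.
Qed.

Lemma iterintD s (G H : paramT -> \bar R) :
  measurable_fun [set: paramT] G -> measurable_fun [set: paramT] H ->
  (forall v, 0 <= G v)%E -> (forall v, 0 <= H v)%E ->
  forall v, (iterint s (fun v => G v + H v) v = iterint s G v + iterint s H v)%E.
Proof.
move=> mG mH G0 H0; elim: s => //= p s IH v.
under eq_integral do rewrite IH.
rewrite ge0_integralD //; try exact: measurable_iterint1.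
- by move=> a _; exact: iterint_ge0.
- by move=> a _; exact: iterint_ge0.
Qed.

Lemma iterintZ s (c : R) (G : paramT -> \bar R) :
  measurable_fun [set: paramT] G -> (forall v, 0 <= G v)%E -> 0 <= c ->
  forall v, (iterint s (fun v => c%:E * G v) v = c%:E * iterint s G v)%E.
Proof.
move=> mG G0 c0; elim: s => //= p s IH v.
under eq_integral do rewrite IH.
rewrite ge0_integralZl //; first exact: measurable_iterint1.
by move=> a _; exact: iterint_ge0.
Qed.

Lemma iterint_cst s (c : \bar R) (v : V) : iterint s (fun=> c) v = c.
Proof.
elim: s v => //= p s IH v.
under eq_integral do rewrite IH.
by rewrite integral_cst //= lebesgue_measure_itv /= lte_fin ltr01 oppr0 adde0 mule1.
Qed.

(** Cutting each integration from [0,1] down to an interval of length [h] drops only nonnegative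
    mass and leaves a factor [h]. Coordinates outside [s] keep their value from [v]; by [uniq s], a
    coordinate once placed in its interval is not overwritten later. *)
Lemma iterint_ge_box s (G : paramT -> \bar R) (lo : V) (h M : R) :
  measurable_fun [set: paramT] G -> (forall v, 0 <= G v)%E ->
  0 < h -> 0 <= M -> uniq s ->
  (forall p, p \in s -> 0 <= lo p.1 p.2 /\ lo p.1 p.2 + h <= 1) ->
  forall v,
  (forall u : V,
     (forall p, p \in s -> lo p.1 p.2 <= u p.1 p.2 <= lo p.1 p.2 + h) ->
     (forall p, p \notin s -> u p.1 p.2 = v p.1 p.2) ->
     (M%:E <= G u)%E) ->
  ((M * h ^+ size s)%:E <= iterint s G v)%E.
Proof.
move=> mG G0 h0 M0; elim: s => /= [_ _ v HM|p s IH /andP[ps us] hlo v HM].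
  by rewrite expr0 mulr1; apply: HM.
have [lo0 lo1] := hlo p (mem_head _ _).
pose B := `[lo p.1 p.2, lo p.1 p.2 + h]%classic.
apply: (@le_trans _ _ (\int[mu]_(a in B) iterint s G (setcoord v p a))%E); last first.
  apply: ge0_subset_integral; [exact: measurable_itv|exact: measurable_itv|..];
    first exact: measurable_iterint1.
    by move=> a _; exact: iterint_ge0.
  move=> a; rewrite /B /= !in_itv /= => /andP[a0 a1].
  by rewrite (le_trans lo0 a0) (le_trans a1 lo1).
apply: (@le_trans _ _ (\int[mu]_(a in B) cst ((M * h ^+ size s)%:E) a)%E); last first.
  apply: ge0_le_integral; [exact: measurable_itv|..] => //.
  - by move=> a _ /=; rewrite lee_fin mulr_ge0 // exprn_ge0 // ltW.
  - apply: measurable_funTS.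
    exact: (measurableT_comp (measurable_iterint s mG G0) (measurable_setcoord1 p v)).
  move=> a; rewrite /B /= in_itv /= => aB.
  apply: IH => //; first by move=> q qs; apply: hlo; rewrite inE qs orbT.
  move=> u us' un; apply: HM => q.
    rewrite inE => /orP[/eqP ->|]; last exact: us'.
    by rewrite (un p ps) /setcoord !eqxx.
  rewrite inE negb_or => /andP[qp qs]; rewrite (un q qs) /setcoord.
  by rewrite -[_ && _]/(q == p) (negbTE qp).
rewrite integral_cst; last exact: measurable_itv.
rewrite /B /= lebesgue_measure_itv /= lte_fin ltrDl h0 -EFinD -EFinM lee_fin.
by rewrite exprSr mulrA addrAC subrr add0r.
Qed.

End ParamSpace.

Lemma cvgr_dist_harmonic (R : realType) (u : nat -> R) (x K : R) :
  (forall n, `|u n - x| <= K * n.+1%:R^-1) -> u @ \oo --> x.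
Proof.
move=> H; apply: cvg_zero.
have cK (c : R) : (c * harmonic n : R) @[n --> \oo] --> (0 : R).
  by rewrite -[X in _ --> X](mulr0 c); apply: cvgMr; exact: cvg_harmonic.
apply: (squeeze_cvgr _ (cK (- K)) (cK K)).
near=> n; have := H n; rewrite ler_norml => /andP[h1 h2].
by rewrite /= mulNr; apply/andP; split.
Unshelve. all: by end_near. Qed.

(** * Simplexes in free coordinates and measurability of Lipschitz functions *)

Section Simplex.
Context {R : realType} {l k : nat}.
Local Notation V := ('I_l -> 'I_k.+1 -> R).
Local Notation pT := (@paramT R l k.+1).

Definition dist1 (w w' : V) : R :=
  \sum_(iota < l) \sum_(j < k.+1 | (val j < k)%N) `|w iota j - w' iota j|.

Definition simplexes : set pT := [set v | inW (complete v)].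

Lemma mem_freecoords (p : 'I_l * 'I_k.+1) :
  (p \in freecoords l k.+1) = (val p.2 < k)%N.
Proof.
rewrite mem_filter /=; case: p => i j /=.
by rewrite allpairs_f ?mem_enum // andbT.
Qed.

Lemma freecoords_uniq : uniq (freecoords l k.+1).
Proof.
by apply/filter_uniq/allpairs_uniq; rewrite ?enum_uniq // => -[i j] [i' j'] _ _.
Qed.

Lemma complete_free (v : V) i (j : 'I_k.+1) : (val j < k)%N -> complete v i j = v i j.
Proof. by rewrite /complete /= => ->. Qed.

(** Completion makes every row sum to 1 by construction; the bound on the free sum is the sign
    condition on the last entry. *)
Lemma inW_completeP (v : V) : inW (complete v) <->
  (forall i (j : 'I_k.+1), (val j < k)%N -> 0 <= v i j) /\
  (forall i, \sum_(j < k.+1 | (val j < k)%N) v i j <= 1).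
Proof.
rewrite /inW /inSimplex; split=> [H|[H1 H2] i].
  split=> [i j jk|i]; first by have [/(_ j) + _] := H i; rewrite complete_free.
  have [/(_ ord_max) + _] := H i.
  by rewrite /complete /= ltnn subr_ge0.
split=> [j|].
  by rewrite /complete /=; case: ifPn => [|_]; [exact: H1|rewrite subr_ge0].
rewrite (bigID (fun j : 'I_k.+1 => (val j < k)%N)) /=.
rewrite (eq_bigr (fun j => v i j)); last by move=> j; exact: complete_free.
rewrite [X in _ + X](big_pred1 ord_max); last first.
  move=> j /=; apply/idP/eqP => [|->]; last by rewrite /= ltnn.
  by rewrite -leqNgt => kj; apply/val_inj/eqP; rewrite /= eqn_leq kj -ltnS ltn_ord.
by rewrite /complete /= ltnn; ring.
Qed.

Lemma measurable_simplexes : measurable simplexes.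
Proof.
rewrite (_ : simplexes = (\bigcap_(ij in [set: 'I_l * 'I_k.+1])
     [set v : pT | (val ij.2 < k)%N -> 0 <= v ij.1 ij.2]) `&`
   \bigcap_(i in [set: 'I_l])
     [set v : pT | \sum_(j < k.+1 | (val j < k)%N) v i j <= 1]); last first.
  apply/seteqP; split=> v; rewrite /simplexes /= inW_completeP => -[h1 h2].
    by split=> [[i j] _ /= jk|i _]; [exact: h1|exact: h2].
  by split=> [i j jk|i]; [exact: (h1 (i, j))|exact: h2].
apply: measurableI; apply: fin_bigcap_measurable; try exact: finite_finset.
  move=> [i j] _ /=; have [jk|jk] := boolP (val j < k)%N.
    rewrite (_ : mkset _ = setT `&` [set v : pT | cst 0 v <= v i j]).
      by apply: measurable_fun_le => //; exact: measurable_coord.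
    by apply/seteqP; split=> v /= h; [split=> //; exact: h|case: h].
  rewrite (_ : mkset _ = setT); first exact: measurableT.
  by apply/seteqP; split=> // v _ /=.
move=> i _.
rewrite (_ : mkset _ = setT `&`
   [set v : pT | \sum_(j < k.+1 | (val j < k)%N) v i j <= cst 1 v]).
  apply: measurable_fun_le => //.
  rewrite (_ : (fun v : pT => _) =
     (fun v : pT => \sum_(j <- [seq j <- index_enum 'I_k.+1 | (val j < k)%N]) v i j)).
    by apply: measurable_sum => j; exact: measurable_coord.
  by apply/funext => v; rewrite big_filter.
by rewrite setTI.
Qed.

(** The floors depend only on the half-open grid cell of side [1/a] containing [v], and there are
    countably many cells, so each preimage is a countable union of measurable cells. *)
Lemma measurable_floor_fun (a : R) (Phi : ('I_l -> 'I_k.+1 -> int) -> R) :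
  0 < a ->
  measurable_fun [set: pT] (fun v : pT => Phi (fun i j => Num.floor (v i j * a))).
Proof.
move=> a0 _ B mB; rewrite setTI.
(* The cell of index [g] if [Phi] takes it into [B], else empty; finite functions as indices make
   the union countable. *)
pose A (g : {ffun 'I_l * 'I_k.+1 -> int}) : set pT :=
  if asbool (B (Phi (fun i j => g (i, j)))) then
  \bigcap_(ij in [set: 'I_l * 'I_k.+1])
    (fun v : pT => v ij.1 ij.2) @^-1` [set` `[(g ij)%:~R / a, (g ij + 1)%:~R / a[ ]
  else set0.
rewrite (_ : _ @^-1` _ = \bigcup_g A g).
  apply: countable_bigcupT_measurable; first exact: countableP.
  move=> g; rewrite /A; case: ifP => // _.
  apply: fin_bigcap_measurable; first exact: finite_finset.
  move=> [i j] _ /=; rewrite -[X in measurable X]setTI.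
  by apply: measurable_coord => //; exact: measurable_itv.
have flE (x : R) (z : int) : (x \in `[z%:~R / a, (z + 1)%:~R / a[) = (Num.floor (x * a) == z).
  rewrite in_itv /= ler_pdivrMr // ltr_pdivlMr //.
  by apply/idP/eqP => [/floor_def //|<-]; exact: floor_itv.
apply/seteqP; split=> [v /= Bv|v [g _]].
  exists [ffun ij => Num.floor (v ij.1 ij.2 * a)] => //; rewrite /A.
  rewrite (_ : (fun i j => _) = (fun i j => Num.floor (v i j * a))); last first.
    by apply/funext => i; apply/funext => j; rewrite ffunE.
  by rewrite asboolT // => -[i j] _ /=; rewrite flE ffunE.
rewrite /A; case: ifPn => // /asboolP Bg vg /=.
rewrite (_ : (fun i j => _) = (fun i j => g (i, j))) //.
apply/funext => i; apply/funext => j; apply/eqP; rewrite -flE.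
exact: (vg (i, j)).
Qed.

(* Rounding the free coordinates down keeps a point of the simplexes inside, so
   a Lipschitz function is there the limit of its values at rounded points. *)
Lemma measurable_lipschitz (F : V -> R) (L : R) : 0 <= L ->
  (forall w w', inW w -> inW w' -> `|F w - F w'| <= L * dist1 w w') ->
  measurable_fun simplexes (fun v : pT => F (complete v)).
Proof.
move=> L0 FL.
pose fl n (v : V) : V := fun i j => (Num.floor (v i j * n.+1%:R))%:~R / n.+1%:R.
refine (@measurable_fun_cvg _ _ _ simplexes (fun n (v : pT) => F (complete (fl n v))) _ _ _).
  move=> n; apply: measurable_funTS.
  exact: (@measurable_floor_fun n.+1%:R
    (fun g => F (complete (fun i j => (g i j)%:~R / n.+1%:R)))).
(* The constant is [L] times the number of free coordinates, each of which rounding moves by at most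
   1/(n+1). *)
move=> v vW; apply: (@cvgr_dist_harmonic _ _ _
  (L * \sum_(i < l) \sum_(j < k.+1 | (val j < k)%N) 1)) => n.
have n0 : 0 < n.+1%:R :> R by rewrite ltr0n.
have [v0 v1] := (inW_completeP v).1 vW.
have fl_le i j : fl n v i j <= v i j by rewrite /fl ler_pdivrMr // floor_le.
have fl_ge i j : v i j - n.+1%:R^-1 <= fl n v i j.
  rewrite /fl ler_pdivlMr // mulrBl mulVf ?gt_eqF // lerBlDr -[1]/(1%:~R) -intrD.
  by have /andP[_ /ltW] := floor_itv (v i j * n.+1%:R).
apply: le_trans (FL _ _ _ vW) _.
  apply/inW_completeP; split=> [i j jk|i].
    by rewrite /fl divr_ge0 // ler0z floor_ge0 mulr_ge0 // v0.
  by apply: le_trans (v1 i); apply: ler_sum => j _; exact: fl_le.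
rewrite -mulrA ler_wpM2l // mulr_suml ler_sum // => i _.
rewrite mulr_suml ler_sum // => j jk.
rewrite !complete_free // mul1r ler_norml; apply/andP; split.
  by rewrite lerBrDr addrC; exact: fl_ge.
by apply: (@le_trans _ _ 0); [rewrite subr_le0|rewrite invr_ge0 ltW].
Qed.

(** * Bounded measurable functions on the parameter space and linearity of the mean *)

Definition integrand (F : V -> R) : Prop :=
  measurable_fun simplexes (fun v : pT => F (complete v)) /\
  exists M, forall w, inW w -> 0 <= F w <= M.

Local Notation restr F := (fun v : V =>
  ((\1_[set v' | inW (complete v')] v) * F (complete v))%:E).

Lemma restrT (F : V -> R) v : inW (complete v) -> restr F v = (F (complete v))%:E.
Proof. by move=> vW /=; rewrite indicE mem_set // mul1r. Qed.

Lemma restrF (F : V -> R) v : ~ inW (complete v) -> restr F v = 0%E.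
Proof. by move=> vW /=; rewrite indicE memNset // mul0r. Qed.

Lemma restr_ge0 F : integrand F -> forall v, (0 <= restr F v)%E.
Proof.
move=> [_ [M FM]] v; have [vW|vW] := pselect (inW (complete v)).
  by rewrite restrT // lee_fin; have /andP[] := FM _ vW.
by rewrite restrF.
Qed.

Lemma measurable_restr F : integrand F ->
  measurable_fun [set: pT] (restr F : pT -> \bar R).
Proof.
move=> [mF _]; apply/measurable_EFinP.
rewrite (_ : (fun v => _) = (fun v : pT => F (complete v)) \_ simplexes).
  exact/(measurable_restrictT _ measurable_simplexes).
by rewrite patch_indic; apply/funext => v /=; rewrite mulrC.
Qed.

Lemma eq_lebW (F G : V -> R) :
  (forall w, inW w -> F w = G w) -> lebW F = lebW G.
Proof.
move=> FG; rewrite /lebW; congr iterint; apply/funext => v.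
have [vW|vW] := pselect (inW (complete v)); first by rewrite !restrT // FG.
by rewrite !restrF.
Qed.

Lemma lebW_ge0 F : integrand F -> (0 <= lebW F)%E.
Proof. by move=> iF; exact: iterint_ge0 (restr_ge0 iF) _. Qed.

Lemma lebW_le F M : integrand F -> 0 <= M -> (forall w, inW w -> F w <= M) ->
  (lebW F <= M%:E)%E.
Proof.
move=> iF M0 FM.
rewrite -[leRHS](iterint_cst (freecoords l k.+1) M%:E (fun _ _ => 0)).
apply: le_iterint.
- exact: measurable_restr.
- exact: measurable_cst.
- exact: restr_ge0.
move=> v; have [vW|vW] := pselect (inW (complete v)).
  by rewrite restrT // lee_fin FM.
by rewrite restrF.
Qed.

(** The reason for the bound in [integrand]: the free coordinates range over a unit cube, so the
    integral is finite and [fine] loses nothing. *)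
Lemma lebW_fin F : integrand F -> lebW F \is a fin_num.
Proof.
move=> iF; rewrite ge0_fin_numE ?lebW_ge0 //; have [_ [M FM]] := iF.
apply: (@le_lt_trans _ _ (Num.max M 0)%:E); last by rewrite ltry.
apply: lebW_le => // [|w wW]; first by rewrite le_max lexx orbT.
by rewrite le_max; have /andP[_ ->] := FM _ wW.
Qed.

Lemma lebWD F G : integrand F -> integrand G ->
  lebW (fun w => F w + G w) = (lebW F + lebW G)%E.
Proof.
move=> iF iG; rewrite /lebW -iterintD //; try exact: measurable_restr;
  try exact: restr_ge0.
by congr iterint; apply/funext => v; rewrite mulrDr EFinD.
Qed.

Lemma lebWZ c F : 0 <= c -> integrand F ->
  lebW (fun w => c * F w) = (c%:E * lebW F)%E.
Proof.
move=> c0 iF; rewrite /lebW -iterintZ //; try exact: measurable_restr;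
  try exact: restr_ge0.
by congr iterint; apply/funext => v; rewrite -EFinM; congr EFin; ring.
Qed.

Lemma integrand_cst c : 0 <= c -> integrand (fun=> c).
Proof. by move=> c0; split; [exact: measurable_cst|exists c => w _; rewrite c0 lexx]. Qed.

Lemma integrandD F G : integrand F -> integrand G -> integrand (fun w => F w + G w).
Proof.
move=> [mF [M FM]] [mG [N GN]]; split; first exact: measurable_funD.
exists (M + N) => w wW; have /andP[? ?] := FM _ wW; have /andP[? ?] := GN _ wW.
by rewrite addr_ge0 // lerD.
Qed.

Lemma integrandM F G : integrand F -> integrand G -> integrand (fun w => F w * G w).
Proof.
move=> [mF [M FM]] [mG [N GN]]; split; first exact: measurable_funM.
exists (M * N) => w wW; have /andP[? ?] := FM _ wW; have /andP[? ?] := GN _ wW.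
by rewrite mulr_ge0 // ler_pM.
Qed.

Lemma integrandZ c F : 0 <= c -> integrand F -> integrand (fun w => c * F w).
Proof. by move=> c0 iF; apply: integrandM => //; exact: integrand_cst. Qed.

Lemma integrand_sum (I : Type) (r : seq I) (a : I -> R) (F : I -> V -> R) :
  (forall i, 0 <= a i) -> (forall i, integrand (F i)) ->
  integrand (fun w => \sum_(i <- r) a i * F i w).
Proof.
move=> a0 iF; elim: r => [|i r IH].
  rewrite (_ : (fun w => _) = fun=> 0); first exact: integrand_cst.
  by apply/funext => w; rewrite big_nil.
rewrite (_ : (fun w => _) = (fun w => a i * F i w + \sum_(i <- r) a i * F i w)).
  by apply: integrandD => //; exact: integrandZ.
by apply/funext => w; rewrite big_cons.
Qed.

Lemma intmu_sum (I : Type) (r : seq I) (a : I -> R) (F : I -> V -> R) :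
  (forall i, 0 <= a i) -> (forall i, integrand (F i)) ->
  intmu (fun w => \sum_(i <- r) a i * F i w) = \sum_(i <- r) a i * intmu (F i).
Proof.
move=> a0 iF; rewrite /intmu.
under [RHS]eq_bigr do rewrite mulrA.
rewrite -mulr_suml; congr (_ / _); elim: r => [|i r IH].
  (* The empty sum is written [0 * 1] so that homogeneity with factor 0 evaluates it. *)
  rewrite big_nil (@eq_lebW _ (fun=> 0 * 1)); last by move=> w _; rewrite big_nil mul0r.
  by rewrite (lebWZ (lexx 0) (integrand_cst ler01)) mul0e.
rewrite big_cons -IH (@eq_lebW _ (fun w => a i * F i w + \sum_(i <- r) a i * F i w)).
  have iF1 := integrandZ (a0 i) (iF i).
  have iFr := integrand_sum r a0 iF.
  rewrite lebWD // fineD ?lebW_fin // lebWZ // fineM ?lebW_fin //.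
by move=> w _; rewrite big_cons.
Qed.

(** * Boxes inside the parameter space and positivity of its volume *)

Lemma lebW_ge_box F (lo : V) (h M : R) :
  integrand F -> 0 < h -> 0 <= M ->
  (forall i (j : 'I_k.+1), (val j < k)%N -> 0 <= lo i j /\ lo i j + h <= 1) ->
  (forall u : V,
     (forall i (j : 'I_k.+1), (val j < k)%N -> lo i j <= u i j <= lo i j + h) ->
     inW (complete u) /\ M <= F (complete u)) ->
  M * h ^+ size (freecoords l k.+1) <= fine (lebW F).
Proof.
move=> iF h0 M0 hlo HM; rewrite -lee_fin fineK ?lebW_fin //.
apply: (@iterint_ge_box _ _ _ _ _ lo) => //.
- exact: measurable_restr.
- exact: restr_ge0.
- exact: freecoords_uniq.
- by move=> [i j]; rewrite mem_freecoords; exact: hlo.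
move=> u Hu _; have [|uW FM] := HM u; last by rewrite restrT // lee_fin.
by move=> i j jk; apply: (Hu (i, j)); rewrite mem_freecoords.
Qed.

(** Shrinking [w] by [1 - d] frees mass [d] in each row, and adding at most [d/(k+1)] per coordinate
    uses no more than that. The two changes together move each free coordinate by at most [d]. *)
Lemma box_inW (w u : V) (d : R) : 0 < d <= 1 -> inW w ->
  (forall i (j : 'I_k.+1), (val j < k)%N ->
     (1 - d) * w i j <= u i j <= (1 - d) * w i j + d / k.+1%:R) ->
  inW (complete u) /\ dist1 (complete u) w <= d * (l%:R * k.+1%:R).
Proof.
move=> /andP[d0 d1] wW Hu.
have k0 : 0 < k.+1%:R :> R by rewrite ltr0n.
have w0 i j : 0 <= w i j by have [] := wW i.
have w1 i j : w i j <= 1.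
  by have [_ <-] := wW i; rewrite (bigD1 j) //= lerDl sumr_ge0.
have d1' : 0 <= 1 - d by rewrite subr_ge0.
split.
  apply/inW_completeP; split=> [i j jk|i].
    by have /andP[+ _] := Hu i j jk; apply: le_trans; rewrite mulr_ge0.
  apply: (@le_trans _ _ (\sum_(j < k.+1) ((1 - d) * w i j + d / k.+1%:R))).
    rewrite [leRHS](bigID (fun j : 'I_k.+1 => (val j < k)%N)) /= -[leLHS]addr0.
    apply: lerD; first by apply: ler_sum => j jk; have /andP[] := Hu i j jk.
    by apply: sumr_ge0 => j _; rewrite addr_ge0 ?mulr_ge0 // ?invr_ge0 ltW.
  rewrite big_split /= -mulr_sumr; have [_ ->] := wW i.
  by rewrite sumr_const card_ord -[(d / _) *+ _]mulr_natr divfK ?gt_eqF //; lra.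
apply: (@le_trans _ _ (\sum_(i < l) \sum_(j < k.+1) d)); last first.
  by rewrite !sumr_const !card_ord -mulrnA -[d *+ _]mulr_natr natrM [k.+1%:R * _]mulrC.
apply: ler_sum => i _; rewrite [leRHS](bigID (fun j : 'I_k.+1 => (val j < k)%N)) /=.
rewrite -[leLHS]addr0; apply: lerD; last by apply: sumr_ge0 => *; exact: ltW.
apply: ler_sum => j jk; rewrite complete_free //; have /andP[h1 h2] := Hu i j jk.
have dk : d / k.+1%:R <= d by rewrite ler_pdivrMr // ler_peMr ?ler1n // ltW.
have dw0 : 0 <= d * w i j by rewrite mulr_ge0 // ltW.
have dw1 : d * w i j <= d by rewrite ler_piMr // ltW.
move: (d / _) (w i j) (u i j) h1 h2 dk dw0 dw1 => q a b h1 h2 dk dw0 dw1.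
by rewrite ler_norml; apply/andP; split; lra.
Qed.

(** Makes the normalization in [intmu] meaningful. This is [box_inW] with [d = 1], where the factor
    [1 - d] removes the base point and leaves a cube at the origin. *)
Lemma lebW1_gt0 : 0 < fine (lebW (fun _ : V => 1 : R)).
Proof.
pose h : R := k.+1%:R^-1.
have h0 : 0 < h by rewrite invr_gt0 ltr0n.
have w0W : inW (complete (fun _ _ => 0) : V).
  by apply/inW_completeP; split=> // i; rewrite big1.
apply: (@lt_le_trans _ _ (1 * h ^+ size (freecoords l k.+1))).
  by rewrite mul1r exprn_gt0.
apply: (@lebW_ge_box _ (fun _ _ => 0)) => //; first exact: integrand_cst.
- by move=> i j _; rewrite lexx add0r invf_le1 ?ltr0n // ler1n.
move=> u Hu.
have d1 : 0 < (1 : R) <= 1 by rewrite ltr01 lexx.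
have [|uW _] := @box_inW _ u _ d1 w0W.
  by move=> i j jk; rewrite subrr mul0r mul1r; exact: Hu.
by split.
Qed.

Lemma lebW1_le1 : fine (lebW (fun _ : V => 1 : R)) <= 1.
Proof.
have i1 : integrand (fun=> 1) by exact: integrand_cst.
by rewrite -lee_fin fineK ?lebW_fin //; exact: lebW_le.
Qed.

Lemma intmu_ge0 F : integrand F -> 0 <= intmu F.
Proof.
by move=> iF; rewrite divr_ge0 // fine_ge0 // lebW_ge0 //; exact: integrand_cst.
Qed.

Lemma eq_intmu (F G : V -> R) : (forall w, inW w -> F w = G w) -> intmu F = intmu G.
Proof. by move=> FG; rewrite /intmu (eq_lebW FG). Qed.

(** The volume of the parameter space in free coordinates is at most 1, so normalizing can only
    enlarge. *)
Lemma intmu_ge F : integrand F -> fine (lebW F) <= intmu F.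
Proof.
move=> iF; rewrite /intmu ler_pdivlMr ?lebW1_gt0 //.
by rewrite ler_piMr ?lebW1_le1 // fine_ge0 // lebW_ge0.
Qed.

End Simplex.

(** * Sublinearity of the logarithm and Bernoulli's inequality *)

Lemma cvg_ln_div (R : realType) (a b : R) : 0 <= a -> 0 <= b ->
  ((a + b * ln n%:R) / n%:R : R) @[n --> \oo] --> (0 : R).
Proof.
move=> a0 b0; apply/cvgrPdist_le => e e0.
(* A slope with [b * q <= e / 2]; [b + 1] in place of [b] covers [b = 0]. *)
pose q := e / (2 * (b + 1)).
have q0 : 0 < q by rewrite divr_gt0 // mulr_gt0 //; lra.
have bq : b * q <= e / 2.
  rewrite /q mulrA ler_pdivrMr; last by rewrite mulr_gt0 //; lra.
  by lra.
near=> n.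
have n1 : 1 <= n%:R :> R.
  by rewrite ler1n; near: n; exact: nbhs_infty_gt.
have n0 : 0 < n%:R :> R by lra.
have ln0 : 0 <= ln n%:R :> R by exact: ln_ge0.
rewrite sub0r normrN ger0_norm; last first.
  by rewrite divr_ge0 ?addr_ge0 ?mulr_ge0 // ltW.
(* Beyond this threshold the constant part [a - b * ln q] uses at most the other half of [e * n]. *)
have nN : 2 * (a - b * ln q) / e <= n%:R.
  by near: n; exact: nbhs_infty_ger.
rewrite ler_pdivrMr //; rewrite ler_pdivrMr // in nN.
have lnq : ln n%:R <= q * n%:R - ln q.
  by rewrite lerBrDr addrC -lnM ?posrE //; exact/ltW/ln_sublinear/mulr_gt0.
have h1 := ler_wpM2l b0 lnq.
have h2 : b * q * n%:R <= e / 2 * n%:R by rewrite ler_wpM2r // ltW.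
move: h1 h2 nN; move: (n%:R : R) (ln _) (ln _) => z y y' h1 h2 nN; nra.
Unshelve. all: by end_near. Qed.

Lemma bernoulli_sub (R : realDomainType) (a : R) n :
  0 <= a <= 1 -> 1 - n%:R * a <= (1 - a) ^+ n.
Proof.
move=> /andP[a0 a1]; elim: n => [|n IH]; first by rewrite mul0r subr0 expr0.
rewrite exprS; apply: le_trans (ler_wpM2l _ IH); last by rewrite subr_ge0.
have : 0 <= n%:R * a * a by rewrite !mulr_ge0.
by rewrite -natr1; lra.
Qed.

(** * Returns of the strategy and of its universalization on a fixed market sequence *)

Section Universal.
Variables (R : realType) (m k l : nat).
Local Notation V := ('I_l -> 'I_k.+1 -> R).
Variable S : (nat -> 'I_m -> R) -> nat -> V -> 'I_m -> R.
Variables (eps c : R).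
Hypothesis m0 : (0 < m)%N.
Hypothesis eps0 : 0 < eps.
Hypothesis c0 : 0 < c.
Variable x : nat -> 'I_m -> R.
Hypothesis x0 : market x.
Hypothesis SW : forall t w, inW w -> inSimplex (S x t w).
Hypothesis SL : forall t i w, inW w ->
  eps / (2 * m%:R * (t%:R + 1) ^+ 2) <= S x t w i.
Hypothesis SD : forall t i w w', inW w -> inW w' ->
  `|S x t w i - S x t w' i| <= c * (t%:R + 1) * dist1 w w'.

Local Notation dim := (size (freecoords l k.+1)).

Let mR : 0 < m%:R :> R. Proof. by rewrite ltr0n. Qed.

Let kR : 0 < k.+1%:R :> R. Proof. by rewrite ltr0n. Qed.

Lemma strategy_gt0 t w i : inW w -> 0 < S x t w i.
Proof.
move=> wW; apply: lt_le_trans (SL t i wW).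
by rewrite divr_gt0 // !mulr_gt0 // ltr_wpDl.
Qed.

Lemma integrand_strategy t i : integrand (fun w => S x t w i).
Proof.
split.
  apply: (@measurable_lipschitz _ _ _ (fun w => S x t w i) (c * (t%:R + 1))).
    by rewrite mulr_ge0 ?addr_ge0 // ltW.
  by move=> w w' wW wW'; exact: SD.
exists 1 => w wW; have [S0 S1] := SW t wW; rewrite S0 /=.
by rewrite -S1 (bigD1 i) //= lerDl sumr_ge0.
Qed.

(** The market returns come first as nonnegative coefficients, the shape used by [integrand_sum] and
    [universalization_sum]. *)
Lemma cumretS n w :
  cumret S x n.+1 w = \sum_(i < m) x n i * (S x n w i * cumret S x n w).
Proof.
rewrite /cumret big_ord_recr /= mulr_sumr; apply: eq_bigr => i _; ring.
Qed.

Lemma integrand_cumret n : integrand (cumret S x n).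
Proof.
elim: n => [|n IH].
  rewrite (_ : cumret S x 0 = fun=> 1); first exact: integrand_cst.
  by apply/funext => w; rewrite /cumret big_ord0.
rewrite (_ : cumret S x n.+1 =
  fun w => \sum_(i < m) x n i * (S x n w i * cumret S x n w)); last first.
  by apply/funext => w; rewrite cumretS.
apply: integrand_sum => i; first exact/ltW/x0.
exact: integrandM (integrand_strategy n i) IH.
Qed.

Lemma cumret_gt0 n w : inW w -> 0 < cumret S x n w.
Proof.
move=> wW; apply: prodr_gt0 => t _.
rewrite (bigD1 (Ordinal m0)) //= ltr_pwDl //.
  by rewrite mulr_gt0 // strategy_gt0.
by apply: sumr_ge0 => i _; rewrite mulr_ge0 // ltW // strategy_gt0.
Qed.

(* On a box of side d / (k+1), d = (scale * N^4)^-1, the l1-distance to w is at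
   most D = l (k+1) d, so each day t < N keeps a fraction of the return of at
   least 1 - 2 m c (t+1)^3 D / eps >= 1 - 1/(2N), hence at least 1/2 over N days. *)
Definition scale : R := 4 * m%:R * c / eps * (l%:R * k.+1%:R) + 1.

Lemma scale_ge1 : 1 <= scale.
Proof. by rewrite /scale lerDr !mulr_ge0 // ?invr_ge0 // ltW. Qed.

Lemma cumret_near N n w u : (0 < N)%N -> (n <= N)%N -> inW w -> inW u ->
  dist1 u w <= (scale * N%:R ^+ 4)^-1 * (l%:R * k.+1%:R) ->
  cumret S x n w / 2 <= cumret S x n u.
Proof.
move=> N0 nN wW uW uw.
have NR : 0 < N%:R :> R by rewrite ltr0n.
have sc : 0 < scale by exact: lt_le_trans scale_ge1.
have a01 : 0 <= (2 * N%:R : R)^-1 <= 1.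
  have N2 : 0 < 2 * N%:R :> R by rewrite mulr_gt0.
  have N1 : 1 <= N%:R :> R by rewrite ler1n.
  by rewrite invr_ge0 (ltW N2) invf_le1 //=; lra.
have day (t : 'I_n) : (1 - (2 * N%:R)^-1) * (\sum_(i < m) S x t w i * x t i) <=
    \sum_(i < m) S x t u i * x t i.
  rewrite mulr_sumr ler_sum // => i _.
  rewrite mulrA ler_wpM2r //; first exact/ltW/x0.
  have tN : t%:R + 1 <= N%:R :> R by rewrite natr1 ler_nat (leq_trans (ltn_ord t)).
  have t0 : 0 < t%:R + 1 :> R by rewrite ltr_wpDl.
  have := SD t i uW wW; rewrite ler_norml => /andP[+ _].
  (* Assets can be compared one by one: it is enough that the Lipschitz bound is at most a fraction
     1/(2N) of the weight at [w]. *)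
  suff : c * (t%:R + 1) * dist1 u w <= (2 * N%:R)^-1 * S x t w i by lra.
  apply: (@le_trans _ _ ((2 * N%:R)^-1 * (eps / (2 * m%:R * (t%:R + 1) ^+ 2)))); last first.
    by apply: ler_wpM2l; [case/andP: a01|exact: SL].
  apply: (@le_trans _ _ (c * (t%:R + 1) * ((scale * N%:R ^+ 4)^-1 * (l%:R * k.+1%:R)))).
    by rewrite ler_wpM2l // mulr_ge0 ?ltW.
  rewrite [leRHS]mulrA ler_pdivlMr ?mulr_gt0 ?exprn_gt0 //.
  rewrite [in leRHS]mulrC ler_pdivlMr ?mulr_gt0 //.
  rewrite (_ : _ * (2 * N%:R) = (4 * m%:R * c * (l%:R * k.+1%:R)) *
     (((t%:R + 1) ^+ 3 * N%:R) / (scale * N%:R ^+ 4))); last by ring.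
  (* Over the common denominator [scale], the numerator [eps * scale] is the required constant plus
     [eps]. *)
  have -> : eps = eps * scale / scale by rewrite mulfK // gt_eqF.
  (* Three of the four factors [N] absorb [(t+1)^3]; the fourth pays for a daily loss of only
     1/(2N). *)
  have h : (t%:R + 1) ^+ 3 * N%:R / (scale * N%:R ^+ 4) <= scale^-1.
    rewrite ler_pdivrMr ?mulr_gt0 ?exprn_gt0 // mulKf ?gt_eqF //.
    rewrite [leRHS]exprSr; apply: ler_wpM2r; first exact: ltW.
    by apply: lerXn2r => //; rewrite nnegrE ltW.
  apply: (@le_trans _ _ (4 * m%:R * c * (l%:R * k.+1%:R) / scale)).
    by rewrite ler_wpM2l // !mulr_ge0 // ltW.
  apply: ler_wpM2r; first by rewrite invr_ge0 ltW.
  rewrite /scale mulrDr mulr1.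
  rewrite (_ : eps * _ = 4 * m%:R * c * (l%:R * k.+1%:R)); first by rewrite lerDl ltW.
  by field; rewrite gt_eqF.
(* By Bernoulli, at most [N] days with loss 1/(2N) each cost at most half. *)
apply: (@le_trans _ _ (\prod_(t < n) ((1 - (2 * N%:R)^-1) * (\sum_(i < m) S x t w i * x t i)))).
  rewrite big_split /= prodr_const card_ord mulrC ler_wpM2r //.
    exact/ltW/cumret_gt0.
  apply: le_trans (bernoulli_sub n a01).
  rewrite lerBrDr -lerBrDl ler_pdivrMr ?mulr_gt0 //.
  have : n%:R <= N%:R :> R by rewrite ler_nat.
  by lra.
apply: ler_prod => t _; rewrite day andbT mulr_ge0 ?subr_ge0 //.
  by case/andP: a01.
by apply: sumr_ge0 => i _; rewrite mulr_ge0 // ltW // strategy_gt0.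
Qed.

(** The box with corner [(1 - d) w] and side [d/(k+1)] lies in the parameter space and near [w], so
    half the return of [w] is reached on all of it. Keeping [N] apart from [n] covers [n = 0]. *)
Lemma lebW_cumret_ge N n w : (0 < N)%N -> (n <= N)%N -> inW w ->
  cumret S x n w / 2 * (scale * N%:R ^+ 4 * k.+1%:R)^-1 ^+ dim
    <= fine (lebW (cumret S x n)).
Proof.
move=> N0 nN wW.
have NR : 1 <= N%:R :> R by rewrite ler1n.
pose d := (scale * N%:R ^+ 4)^-1.
have d01 : 0 < d <= 1.
  have s1 := scale_ge1.
  have N4 : 1 <= N%:R ^+ 4 :> R by rewrite exprn_ege1.
  have sN : 1 <= scale * N%:R ^+ 4 by rewrite mulr_ege1.
  by rewrite invr_gt0 invf_le1 (lt_le_trans ltr01 sN).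
have [d0 d1] := andP d01.
have w0 i j : 0 <= w i j by have [] := wW i.
have w1 i j : w i j <= 1.
  by have [_ <-] := wW i; rewrite (bigD1 j) //= lerDl sumr_ge0.
rewrite invfM -/d.
apply: (@lebW_ge_box _ _ _ _ (fun i j => (1 - d) * w i j)).
- exact: integrand_cumret.
- by rewrite divr_gt0.
- by rewrite ltW // divr_gt0 // cumret_gt0.
- move=> i j _; rewrite mulr_ge0 ?subr_ge0 //; split=> //.
  have h1 : (1 - d) * w i j <= 1 - d by rewrite ler_piMr // subr_ge0.
  have h2 : d / k.+1%:R <= d by rewrite ler_pdivrMr // ler_peMr ?ler1n // ltW.
  by move: h1 h2; move: (_ * w i j) (d / _) => y z; lra.
move=> u Hu; have [uW duw] := box_inW d01 wW Hu.
by split=> //; exact: cumret_near duw.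
Qed.

(** Allows division by the denominators of the universalization. The box bound is taken with
    [N = n + 1] at the vertex whose rows have last entry 1. *)
Lemma intmu_cumret_gt0 n : 0 < intmu (cumret S x n).
Proof.
have wW : inW (complete (fun _ _ => 0) : V).
  by apply/inW_completeP; split=> // i; rewrite big1.
apply: lt_le_trans (intmu_ge (integrand_cumret n)).
apply: lt_le_trans (lebW_cumret_ge (ltn0Sn n) (leqnSn n) wW).
rewrite mulr_gt0 ?divr_gt0 ?cumret_gt0 // exprn_gt0 // invr_gt0 !mulr_gt0 //.
by rewrite (lt_le_trans ltr01 scale_ge1).
Qed.

(** Used with [a = 1] for the total weight and with [a = x t] for the daily return. *)
Lemma universalization_sum t (a : 'I_m -> R) : (forall i, 0 <= a i) ->
  \sum_(i < m) universalization S x t i * a i =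
  intmu (fun w => \sum_(i < m) a i * (S x t w i * cumret S x t w))
    / intmu (cumret S x t).
Proof.
move=> a0; rewrite intmu_sum //; last first.
  by move=> i; exact: integrandM (integrand_strategy t i) (integrand_cumret t).
by rewrite mulr_suml; apply: eq_bigr => i _; rewrite /universalization mulrC mulrA.
Qed.

Lemma universalization_inSimplex t : inSimplex (universalization S x t).
Proof.
split=> [i|].
  rewrite divr_ge0 //; apply: intmu_ge0; last exact: integrand_cumret.
  exact: integrandM (integrand_strategy t i) (integrand_cumret t).
have := universalization_sum t (fun=> ler01).
under eq_bigr do rewrite mulr1.
move=> ->; rewrite (@eq_intmu _ _ _ _ (cumret S x t)) ?divff ?gt_eqF ?intmu_cumret_gt0 //.
move=> w wW; under eq_bigr do rewrite mul1r.
by rewrite -mulr_suml; have [_ ->] := SW t wW; rewrite mul1r.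
Qed.

(** The return of day [t] is the ratio of the means of [cumret] at [t + 1] and at [t], so the
    product telescopes from 1. *)
Lemma cumret0_universalization n :
  cumret0 (universalization S) x n = intmu (cumret S x n).
Proof.
elim: n => [|n IH].
  rewrite /cumret0 big_ord0 (@eq_intmu _ _ _ _ (fun=> 1)).
    by rewrite /intmu divff // gt_eqF // lebW1_gt0.
  by move=> w _; rewrite /cumret big_ord0.
rewrite /cumret0 big_ord_recr /= -/(cumret0 _ _ _) IH universalization_sum; last first.
  by move=> i; exact/ltW/x0.
rewrite mulrC divfK ?gt_eqF ?intmu_cumret_gt0 //.
by apply: eq_intmu => w _; rewrite cumretS.
Qed.

(** The logarithm of the box bound with [N = n]: halving the return costs [ln 2], and the box volume
    accounts for the terms with [dim]. *)
Lemma Lgrowth_universalization n w : (0 < n)%N -> inW w ->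
  Lgrowth n (cumret S x n w) -
    (ln 2 + dim%:R * ln (scale * k.+1%:R) + 4 * dim%:R * ln n%:R) / n%:R
  <= Lgrowth n (cumret0 (universalization S) x n).
Proof.
move=> n0 wW; have nR : 0 < n%:R :> R by rewrite ltr0n.
have sc : 0 < scale by exact: lt_le_trans scale_ge1.
have n4 : 0 < n%:R ^+ 4 :> R by rewrite exprn_gt0.
have rw := cumret_gt0 n wW.
rewrite /Lgrowth -mulrBl ler_pM2r ?invr_gt0 // cumret0_universalization.
have low := le_trans (lebW_cumret_ge n0 (leqnn n) wW) (intmu_ge (integrand_cumret n)).
have B0 : 0 < scale * n%:R ^+ 4 * k.+1%:R by rewrite !mulr_gt0.
have h0 : 0 < (scale * n%:R ^+ 4 * k.+1%:R)^-1 ^+ dim by rewrite exprn_gt0 // invr_gt0.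
have := low; rewrite -ler_ln ?posrE ?intmu_cumret_gt0 //; last first.
  by rewrite mulr_gt0 // divr_gt0.
apply: le_trans.
rewrite [leRHS]lnM ?posrE ?divr_gt0 // ln_div ?posrE // lnXn ?invr_gt0 // lnV ?posrE //.
have -> : ln (scale * n%:R ^+ 4 * k.+1%:R) = ln (scale * k.+1%:R) + 4 * ln n%:R.
  by rewrite [X in ln X = _]mulrAC [LHS]lnM ?posrE ?mulr_gt0 // [ln (_ ^+ 4)]lnXn // mulr_natl.
rewrite -mulr_natr.
by lra.
Qed.

End Universal.

Theorem theorem3p1 (R : realType) (m k l : nat)
  (hm : (2 <= m)%N) (hk : (2 <= k)%N) (hl : (1 <= l)%N)
  (S : (nat -> 'I_m -> R) -> nat -> ('I_l -> 'I_k -> R) -> 'I_m -> R)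
  (eps c : R) (heps0 : 0 < eps) (heps1 : eps < 1) (hc : 0 < c)
  (hSna : nonanticipating S)
  (hSW : forall x, market x -> forall t w, inW w -> inSimplex (S x t w))
  (hL : forall x, market x -> forall t i w, inW w ->
          eps / (2 * m%:R * (t%:R + 1) ^+ 2) <= S x t w i)
  (hD : forall x, market x -> forall t i w w', inW w -> inW w' ->
          `|S x t w i - S x t w' i| <=
            c * (t%:R + 1) *
            \sum_(iota < l) \sum_(j < k | (val j < k.-1)%N) `|w iota j - w' iota j|) :
  is_universalization (universalization S) S.
Proof.
(* With [k] a successor, [k.-1] reduces and the sum in [hD] becomes [dist1]. *)
case: k hk S hSna hSW hL hD => // k _ S hSna hSW hL hD.
have m0 : (0 < m)%N by exact: ltnW.
split.
(* Day [t] involves the market through [S x t] and through the returns of earlier days, all fixed by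
   the data before [t]. *)
- move=> x y t xy; rewrite /universalization (hSna _ _ _ xy).
  suff -> : cumret S x t = cumret S y t by [].
  apply/funext => w; apply: eq_bigr => s _; rewrite xy // (hSna x y s) // => r rs.
  by rewrite xy // (ltn_trans rs).
- move=> x x0 t.
  exact: (universalization_inSimplex m0 heps0 hc x0 (hSW x x0) (hL x x0) (hD x x0)).
pose dim := size (freecoords l k.+1).
(* Apart from [n], only [m], [k], [l], [eps] and [c] enter, so one sequence serves all markets. *)
exists (fun n => (ln 2 + dim%:R * ln (scale m k l eps c * k.+1%:R)
                  + 4 * dim%:R * ln n%:R) / n%:R); split.
  apply: cvg_ln_div; last by rewrite mulr_ge0.
  rewrite addr_ge0 ?mulr_ge0 // ln_ge0 ?ler1n //.
  by rewrite mulr_ege1 ?ler1n // scale_ge1.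
move=> n n0 x x0 w wW.
exact: (Lgrowth_universalization m0 heps0 hc x0 (hSW x x0) (hL x x0) (hD x x0)).
Qed.
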